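(* Let $f:\{0,1\}^n\to\{0,1\}$ be a total function. Then $\mathrm{R}_0(f)=O(\mathrm{RS}(f)^2\log\mathrm{RS}(f))$, or alternately, $\mathrm{RS}(f)=\Omega\big(\sqrt{\mathrm{R}_0(f)/\log\mathrm{R}_0(f)}\big)$.
   Context: A randomized query algorithm is a probability distribution over deterministic decision trees; $\mathrm{R}_0(h)$ is the minimum, over randomized algorithms always correct on every input in the domain of $h$, of the maximum over inputs of the expected number of queries. Query notions apply to alphabet $\{0,1,*,\dagger\}$. Sabotage: $P_f\subseteq\{0,1,*\}^n$ is the set of $p$ for which there exist $x,y\in\{0,1\}^n$ with $f(x)\ne f(y)$ and $x_i=y_i=p_i$ whenever $p_i\ne*$; $P_f^\dagger$ is the same with $\dagger$ in place of $*$; $Q_f=P_f\cup P_f^\dagger$; $f_{\mathrm{sab}}:Q_f\to\{0,1\}$ is $0$ on $P_f$ and $1$ on $P_f^\dagger$; $\mathrm{RS}(f)=\mathrm{R}_0(f_{\mathrm{sab}})$. *)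

(* Defs.v *)
(* MathComp / MathComp-Analysis *)
From HB Require Import structures.
From mathcomp Require Import all_boot all_order all_algebra.
From mathcomp Require Import all_classical all_reals all_analysis.

Set Implicit Arguments.
Unset Strict Implicit.
Unset Printing Implicit Defensive.

Import Order.TTheory GRing.Theory Num.Theory.
Import numFieldNormedType.Exports.

Local Open Scope classical_set_scope.
Local Open Scope ring_scope.

(* Deterministic decision trees querying positions of a word in A^n.  A tree
   may query a position repeatedly along a path; every query is counted. *)
Inductive dtree (A : finType) (n : nat) : Type :=
  | Answer of bool
  | Query of 'I_n & (A -> dtree A n).

Arguments Answer {A n}.
Arguments Query {A n}.

Section DTreeInstances.
Variables (A : finType) (n : nat).

HB.instance Definition _ := gen_eqMixin (dtree A n).
HB.instance Definition _ := gen_choiceMixin (dtree A n).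
HB.instance Definition _ := isPointed.Build (dtree A n) (Answer false).

(* As A is finite, dtree A n is countable, so probability measures for the
   discrete sigma-algebra are exactly the probability mass functions on trees. *)
HB.instance Definition _ := @isMeasurable.Build default_measure_display
  (dtree A n) discrete_measurable discrete_measurable0
  discrete_measurableC discrete_measurableU.

End DTreeInstances.

Section QueryComplexity.
Variables (A : finType) (n : nat).

Implicit Types (t : dtree A n) (x : {ffun 'I_n -> A}).

Fixpoint output t x : bool :=
  match t with
  | Answer b => b
  | Query i k => output (k (x i)) x
  end.

Fixpoint queries t x : nat :=
  match t with
  | Answer _ => 0%N
  | Query i k => (queries (k (x i)) x).+1
  end.

(* A partial Boolean function on A^n; its domain is where it is not None. *)
Definition pfun := {ffun 'I_n -> A} -> option bool.

Definition computes (h : pfun) t : Prop :=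
  forall x b, h x = Some b -> output t x = b.

Variable R : realType.

Definition zero_error (h : pfun) (P : probability (dtree A n) R) : Prop :=
  P [set t | computes h t] = 1%E.

(* Worst-case expected number of queries over the domain of h; it is 0 when
   that domain is empty. *)
Definition worst_cost (h : pfun) (P : probability (dtree A n) R) : \bar R :=
  (\big[maxe/0]_(x : {ffun 'I_n -> A} | isSome (h x))
     'E_P[fun t => (queries t x)%:R])%E.

(* The infimum is attained, and lies in [0, n], so that fine is harmless. *)
Definition R0 (h : pfun) : R :=
  fine (ereal_inf [set worst_cost h P | P in [set P | zero_error h P]]).

End QueryComplexity.

Inductive symbol : Type := Bit of bool | Star | Dagger.

Definition symbol_code (s : symbol) : option (option bool) :=
  match s with Bit b => Some (Some b) | Star => Some None | Dagger => None end.

Definition symbol_decode (c : option (option bool)) : symbol :=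
  match c with Some (Some b) => Bit b | Some None => Star | None => Dagger end.

Lemma symbol_codeK : cancel symbol_code symbol_decode.
Proof. by case. Qed.

HB.instance Definition _ := Finite.copy symbol (can_type symbol_codeK).

Section Sabotage.
Variables (n : nat) (f : {ffun 'I_n -> bool} -> bool).

(* sab_inputs Star is P_f and sab_inputs Dagger is its dagger variant: since
   entries other than s must be bits, no third special symbol occurs. *)
Definition sab_inputs (s : symbol) : {set {ffun 'I_n -> symbol}} :=
  [set p : {ffun 'I_n -> symbol} |
    [exists x : {ffun 'I_n -> bool}, exists y : {ffun 'I_n -> bool},
      (f x != f y) &&
      [forall i, (p i != s) ==> (Bit (x i) == p i) && (Bit (y i) == p i)]]].

(* The two sets are disjoint, as f x != f y forces p to have an entry s. *)
Definition fsab : pfun symbol n := fun p =>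
  if p \in sab_inputs Star then Some false
  else if p \in sab_inputs Dagger then Some true
  else None.

Definition pfun_of : pfun bool n := fun x => Some (f x).

Variable R : realType.

Definition RS : R := R0 R fsab.

End Sabotage.

(* Main.v *)
Require Import Defs.
From HB Require Import structures.
From mathcomp Require Import all_boot all_order all_algebra.
From mathcomp Require Import all_classical all_reals all_analysis.
From mathcomp Require Import fintype finset lra.

(** Two inputs x, y with f x <> f y give two sabotaged words that agree with x
    outside the block where x and y differ, so every zero-error tree must query
    that block.  Run on the input x and cut off after T = O(RS f) queries, the
    sabotage algorithm therefore hits every sensitive block of x with
    probability at least 1/2.  Double counting then bounds the sensitivity of f,
    hence the size of minimal sensitive blocks, by 2T, and (removing one hit
    position at a time) the number of minimal blocks of size s by (2T)^s.  By a
    union bound, O(T log T) independent runs hit all minimal blocks of x, that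
    is, reveal a certificate of x.

    Both logarithms are bounded away from 0: if RS f < 3/2 or R0 f < 3/2, then
    one query hits every sensitive block with probability more than 1/2, so f
    has sensitivity at most 1, hence is constant or a dictator and both
    complexities are at most 1. *)

Set Implicit Arguments.
Unset Strict Implicit.
Unset Printing Implicit Defensive.

Import Order.TTheory GRing.Theory Num.Theory.
Local Open Scope ring_scope.

(** * Finite mixtures of decision trees *)

Section Mixtures.
Local Open Scope classical_set_scope.

Lemma worst_cost_ge0 A n R (h : pfun A n) (P : probability (dtree A n) R) :
  (0 <= worst_cost h P)%E.
Proof.
rewrite /worst_cost; elim/big_rec: _ => // x e _ e0.
by rewrite le_max e0 orbT.
Qed.

Lemma expectation_le_worst_cost A n R (h : pfun A n)
    (P : probability (dtree A n) R) x : isSome (h x) ->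
  ('E_P[fun t => (queries t x)%:R] <= worst_cost h P)%E.
Proof.
move=> hx; rewrite /worst_cost (bigD1 x) //=.
by rewrite le_max lexx.
Qed.

Lemma worst_cost_le A n (R : realType) (h : pfun A n)
    (P : probability (dtree A n) R) (c : R) : 0 <= c ->
  (forall x, isSome (h x) -> 'E_P[fun t => (queries t x)%:R] <= c%:E)%E ->
  (worst_cost h P <= c%:E)%E.
Proof.
move=> c0 H; rewrite /worst_cost; elim/big_rec: _ => [|x e /H Hx ec].
  by rewrite lee_fin.
by rewrite ge_max Hx.
Qed.

(** The measure is a finite sum of point masses [w i] at [t i]. Since [msum] takes measures indexed
    by numbers, [I] is enumerated through [e]. *)
Lemma mixture_probability A n (R : realType) (I : finType) (w : I -> R)
    (t : I -> dtree A n) : (forall i, 0 <= w i) -> \sum_i w i = 1 ->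
  exists P : probability (dtree A n) R,
    (forall S : set (dtree A n), (forall i, S (t i)) -> P S = 1%E) /\
    (forall X : dtree A n -> R, (forall u, (0 <= X u)%R) ->
      'E_P[X] = (\sum_i w i * X (t i))%:E)%E.
Proof.
move=> w0 w1.
have [i0 _|I0] := pickP (@predT I); last first.
  by move: w1; rewrite big_pred0 // => /eqP; rewrite eq_sym oner_eq0.
pose e k := nth i0 (enum I) k.
pose m_ k : {measure set (dtree A n) -> \bar R} :=
  mscale (NngNum (w0 (e k))) (\d_(t (e k))).
pose m : {measure set (dtree A n) -> \bar R} := msum m_ #|I|.
have sumE (F : I -> R) : (\sum_(k < #|I|) (F (e k))%:E = (\sum_i F i)%:E)%E.
  rewrite sumEFin -(big_mkord xpredT (fun k => F (e k))) cardE /e.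
  by rewrite -(big_nth i0 xpredT F) big_enum.
have mT (S : set (dtree A n)) : (forall i, S (t i)) -> m S = 1%E.
  move=> St; rewrite -w1 -(sumE w).
  by apply: eq_bigr => k _; rewrite /= /mscale /= diracE mem_set // mule1.
have mP : m classical_sets.setT = 1%E by exact: mT.
pose P : probability (dtree A n) R := HB.pack (Measure.sort m)
  (Measure_isProbability.Build _ _ _ m mP).
exists P; split=> // X X0.
rewrite unlock.
transitivity (\int[m]_u (X u)%:E)%E; first exact: eq_measure_integral.
rewrite /m ge0_integral_measure_sum //; last by move=> u _; rewrite lee_fin.
rewrite -(sumE (fun i => w i * X (t i))); apply: eq_bigr => k _.
rewrite ge0_integral_mscale //; last by move=> u _; rewrite lee_fin.
rewrite integral_dirac //.
by rewrite diracT mul1e.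
Qed.

Lemma R0_le_mixture A n (R : realType) (h : pfun A n) (I : finType) (w : I -> R)
    (t : I -> dtree A n) (c : R) :
  (forall i, 0 <= w i) -> \sum_i w i = 1 -> (forall i, computes h (t i)) ->
  0 <= c ->
  (forall x, isSome (h x) -> \sum_i w i * (queries (t i) x)%:R <= c) ->
  R0 R h <= c.
Proof.
move=> w0 w1 ht c0 hc.
have [P [PS PE]] := mixture_probability t w0 w1.
have inf0 : (0 <= ereal_inf [set worst_cost h P0 |
    P0 in [set P0 : probability (dtree A n) R | zero_error h P0]])%E.
  by apply: le_ereal_inf_tmp => _ [Q _ <-]; exact: worst_cost_ge0.
have infc : (ereal_inf [set worst_cost h P0 |
    P0 in [set P0 : probability (dtree A n) R | zero_error h P0]] <= c%:E)%E.
  apply: ge_ereal_inf; exists (worst_cost h P).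
    by exists P => //; exact: PS.
  by apply: worst_cost_le => // x /hc; rewrite PE // lee_fin.
by rewrite -lee_fin /R0 fineK // ge0_fin_numE // (le_lt_trans infc) ?ltry.
Qed.

Lemma total_tree (A : finType) n (a0 : A) (g : {ffun 'I_n -> A} -> bool) :
  exists t : dtree A n, forall x, output t x = g x /\ queries t x = n.
Proof.
(* [full s z] queries the positions of [s] in order and records the answers in [z], on which [g] is
   evaluated at the end. *)
pose fix full (s : seq 'I_n) (z : {ffun 'I_n -> A}) {struct s} : dtree A n :=
  if s is i :: s' then Query i (fun a => full s' [ffun j => if j == i then a else z j])
  else Answer (g z).
have fullq s : forall z x, queries (full s z) x = size s.
  by elim: s => //= i s IH z x; rewrite IH.
have fullo s : forall z x, output (full s z) x =
    g [ffun i => if i \in s then x i else z i].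
  elim: s => [|i s IH] z x /=; first by congr g; apply/ffunP => j; rewrite ffunE.
  rewrite IH; congr g; apply/ffunP => j; rewrite !ffunE inE.
  by have [->|] := eqVneq j i; first case: ifP.
exists (full (enum 'I_n) [ffun=> a0]) => x; rewrite fullq size_enum_ord fullo; split=> //.
by congr g; apply/ffunP => i; rewrite ffunE mem_enum.
Qed.

Lemma computes_tree (A : finType) n (a0 : A) (h : pfun A n) :
  exists t : dtree A n, computes h t /\ forall x, queries t x = n.
Proof.
have [t Ht] := total_tree a0 (fun x => odflt false (h x)).
exists t; split=> [x b hx|x]; last by rewrite (Ht x).2.
by rewrite (Ht x).1 hx.
Qed.

(** A near-optimal measure may charge infinitely many trees. Once costs are cut off at [M], only
    finitely many cost profiles [phi] remain, so one representative per profile, weighted by the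
    mass of its class, has the same truncated expected costs. *)
Lemma mixture_of_R0 (A : finType) n (a0 : A) (R : realType) (h : pfun A n)
    (c : R) (M : nat) :
  R0 R h < c ->
  exists (I : finType) (w : I -> R) (t : I -> dtree A n),
  [/\ forall i, 0 <= w i, \sum_i w i = 1, forall i, computes h (t i) &
    forall x, isSome (h x) -> \sum_i w i * (minn (queries (t i) x) M)%:R <= c].
Proof.
have [t0 [ht0 qt0]] := computes_tree a0 h.
set S := [set worst_cost h P0 |
    P0 in [set P0 : probability (dtree A n) R | zero_error h P0]].
have infS0 : (0 <= ereal_inf S)%E.
  by apply: le_ereal_inf_tmp => _ [Q _ <-]; exact: worst_cost_ge0.
have infSn : (ereal_inf S <= n%:R%:E)%E.
  have [] := @mixture_probability A n R unit (fun=> 1) (fun=> t0).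
  - by [].
  - by rewrite big_const card_unit /= addr0.
  move=> P [PS PE]; apply: ge_ereal_inf; exists (worst_cost h P).
    by exists P => //; exact: PS.
  apply: worst_cost_le => // x _; rewrite PE // lee_fin.
  by rewrite big_const card_unit /= addr0 mul1r qt0.
have finS : ereal_inf S \is a fin_num
  by rewrite ge0_fin_numE // (le_lt_trans infSn) ?ltry.
rewrite /R0 -lte_fin -/S fineK // => /ereal_inf_lt[_ [P Pz <-] Pc].
pose C := [set t | computes h t].
pose phi (t : dtree A n) : {ffun {ffun 'I_n -> A} -> 'I_M.+1} :=
  [ffun x => inord (minn (queries t x) M)].
pose B j := [set t | phi t = j] `&` C.
pose w j := fine (P (B j)).
have wE j : P (B j) = (w j)%:E by rewrite fineK // fin_num_measure.
(* A class of mass 0 may be empty; [t0] then stands in for it, at weight 0. *)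
have rep j : exists t, computes h t /\ (w j != 0 -> phi t = j).
  have [wj|wj] := eqVneq (w j) 0; first by exists t0.
  have /set0P[t [tj tC]] : B j != classical_sets.set0.
    by apply: contra_neq wj => Bj; rewrite /w Bj measure0.
  by exists t.
have /choice[t Ht] := rep.
have phiE u x : phi u x = minn (queries u x) M :> nat.
  by rewrite ffunE inordK // ltnS geq_minr.
have intE (v : {ffun {ffun 'I_n -> A} -> 'I_M.+1} -> R) : (forall j, 0 <= v j) ->
    (\sum_j w j * v j)%:E = (\int[P]_u (v (phi u) * \1_C u)%:E)%E.
  move=> v0.
  transitivity (\int[P]_u (\sum_j (v j * \1_(B j) u)%:E))%E.
    rewrite ge0_integral_sum //; last by move=> j u _; rewrite lee_fin mulr_ge0.
    rewrite -sumEFin; apply: eq_bigr => j _.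
    under eq_integral => u _ do rewrite EFinM.
    rewrite ge0_integralZl ?lee_fin //.
    by rewrite integral_indic // classical_sets.setIT [X in (_ * X)%E](wE j)
      -EFinM mulrC.
  apply: eq_integral => u _; rewrite sumEFin; congr EFin.
  rewrite (bigD1 (phi u)) //= big1 ?addr0 => [|j ju].
    by congr (_ * _); rewrite !indicE; congr (nat_of_bool _)%:R; apply/idP/idP;
      rewrite !in_setE; [case|move=> ?; split].
  rewrite indicE memNset ?mulr0 // => -[uj _]; move: ju.
  by rewrite -uj eqxx.
exists {ffun {ffun 'I_n -> A} -> 'I_M.+1}, w, t; split=> [j||j|x hx].
- by rewrite fine_ge0.
- apply/EFin_inj; transitivity (\sum_j w j * 1)%:E.
    by congr EFin; apply: eq_bigr => j _; rewrite mulr1.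
  rewrite (intE (fun=> 1)) //.
  under eq_integral => u _ do rewrite mul1r.
  by rewrite integral_indic // classical_sets.setIT.
- exact: (Ht j).1.
- rewrite -lee_fin; apply: le_trans (ltW Pc).
  apply: le_trans (expectation_le_worst_cost P hx).
  have -> : \sum_i w i * (minn (queries (t i) x) M)%:R = \sum_i w i * (i x)%:R.
    apply: eq_bigr => j _; have [->|wj] := eqVneq (w j) 0; first by rewrite !mul0r.
    by rewrite -phiE (Ht j).2.
  rewrite (intE (fun j => (j x)%:R)) // unlock; apply: ge0_le_integral => //.
  move=> u _; rewrite lee_fin phiE indicE.
  case: (_ \in _); rewrite ?mulr1 ?mulr0 ?ler0n // ler_nat; exact: geq_minl.
Qed.

End Mixtures.

(** * Truncated trees hit sensitive blocks *)

Fixpoint queried A n (t : dtree A n) (x : {ffun 'I_n -> A}) : {set 'I_n} :=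
  if t is Query i k then i |: queried (k (x i)) x else set0.

Lemma card_queried A n (t : dtree A n) x : (#|queried t x| <= queries t x)%N.
Proof.
elim: t => [b|i k IH] /=; first by rewrite cards0.
by rewrite cardsU1 (leq_add (leq_b1 _) (IH _)).
Qed.

(* Only the queries of a truncated tree matter; its answer is junk. *)
Fixpoint trunc (A : finType) n (e : bool -> A) (T : nat) (t : dtree A n) : dtree bool n :=
  match T, t with
  | T'.+1, Query i k => Query i (fun b => trunc e T' (k (e b)))
  | _, _ => Answer false
  end.

Lemma queries_trunc (A : finType) n (e : bool -> A) T (t : dtree A n) x :
  (queries (trunc e T t) x <= T)%N.
Proof. by elim: T t => [|T IH] [b|i k] //=; rewrite ltnS. Qed.

(** On [p] the tree [t] follows the path that its truncation takes on [x], and it stops before the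
    cutoff. The same path is followed on [q], so both runs end in the same leaf. *)
Lemma eq_output_trunc (A : finType) n (e : bool -> A) T (t : dtree A n) x
    (p q : {ffun 'I_n -> A}) :
  (forall i, i \in queried (trunc e T t) x -> p i = e (x i) /\ q i = e (x i)) ->
  (queries t p <= T)%N -> output t p = output t q.
Proof.
elim: T t => [|T IH] [b|i k] //= H.
have [pi qi] := H i (setU11 _ _).
rewrite ltnS pi qi; apply: IH => j jQ; apply: H.
by rewrite inE jQ orbT.
Qed.

Definition pdiff n (x y : {ffun 'I_n -> bool}) : {set 'I_n} := [set i | x i != y i].

(* Covers both h = fsab f with e = Bit and h = pfun_of f with e = id. *)
Definition sabotages (A : finType) n (h : pfun A n) (e : bool -> A)
    (f : {ffun 'I_n -> bool} -> bool) :=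
  forall x y, f x != f y -> exists p q bp bq,
    [/\ h p = Some bp, h q = Some bq, bp != bq &
     forall i, i \notin pdiff x y -> p i = e (x i) /\ q i = e (x i)].

Lemma pfun_of_sabotages n (f : {ffun 'I_n -> bool} -> bool) :
  sabotages (pfun_of f) id f.
Proof.
move=> x y fxy; exists x, y, (f x), (f y); split=> // i.
by rewrite inE negbK => /eqP.
Qed.

Lemma fsab_sabotages n (f : {ffun 'I_n -> bool} -> bool) : sabotages (fsab f) Bit f.
Proof.
move=> x y fxy.
pose p s := [ffun i => if x i == y i then Bit (x i) else s].
have pin s : p s \in sab_inputs f s.
  rewrite inE; apply/existsP; exists x; apply/existsP; exists y; rewrite fxy /=.
  apply/forallP => i; rewrite ffunE.
  by case: (x i =P y i) => [<-|_]; rewrite !eqxx ?implybT.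
have [i xyi] : exists i, x i != y i.
  apply/existsP; apply: contraNT fxy => /existsPn H; apply/eqP; congr f.
  by apply/ffunP => i; apply/eqP; move: (H i); rewrite negbK.
exists (p Star), (p Dagger), false, true; split=> //.
- by rewrite /fsab pin.
(* The entry of [p Dagger] at [i] is a dagger, neither a star nor a bit, which keeps this word out
   of [sab_inputs f Star]. *)
- rewrite /fsab pin ifF //; apply/negbTE; rewrite inE.
  apply/existsP => -[x' /existsP[y' /andP[_ /forallP/(_ i)]]].
  by rewrite ffunE (negbTE xyi).
- by move=> j; rewrite inE negbK !ffunE => /eqP ->; rewrite eqxx.
Qed.

(* The - 1 comes from the first query, which no tree computing h can avoid; with
   T = 1 it gives the gap between 1 and 3/2. *)
Lemma truncated_mixture (A : finType) n (a0 : A) (R : realType) (h : pfun A n)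
    (e : bool -> A) (f : {ffun 'I_n -> bool} -> bool) (c : R) (T : nat) :
  sabotages h e f -> R0 R h < c ->
  exists (I : finType) (w : I -> R) (t : I -> dtree bool n),
  [/\ forall i, 0 <= w i, \sum_i w i = 1, forall i x, (queries (t i) x <= T)%N &
    forall x y, f x != f y ->
      T%:R * \sum_i w i * [disjoint queried (t i) x & pdiff x y]%:R <= c - 1].
Proof.
move=> hef /(mixture_of_R0 a0 T.+1)[I [w [t [w0 w1 ht hc]]]].
exists I, w, (fun i => trunc e T (t i)); split=> // [i x|x y fxy].
  exact: queries_trunc.
have [p [q [bp [bq [hp hq bpq pq]]]]] := hef _ _ fxy.
have outpq i : output (t i) p <> output (t i) q.
  by rewrite (ht i _ _ hp) (ht i _ _ hq); exact/eqP.
(* Each tree is charged on [p]: at least 1 query always, and at least [T.+1] if its truncation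
   misses the block. Otherwise it would answer alike on [p] and [q]. *)
rewrite lerBrDl; apply: le_trans (hc p _); last by rewrite hp.
rewrite -[X in X + _]w1 mulr_sumr -big_split /=; apply: ler_sum => i _.
rewrite mulrCA -{1}[w i]mulr1 -mulrDr; apply: ler_wpM2l => //.
rewrite -natrM nat1r ler_nat leq_min ltnS.
apply/andP; split; last by case: [disjoint _ & _]; rewrite ?muln1 ?muln0.
rewrite ltnNge; apply/negP => H; apply: (outpq i).
case: (boolP [disjoint _ & _]) H => [dis|_].
  rewrite muln1; apply: eq_output_trunc => j jQ; apply: pq.
  by rewrite (disjointFr dis jQ).
(* A tree making no query is excluded by the case of cutoff 0, where the set of queried positions is
   empty. *)
rewrite muln0; apply: (@eq_output_trunc _ _ e _ _ x) => j.
by case: (t i) => [b|k u]; rewrite inE.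
Qed.

(** * Minimal sensitive blocks *)

Definition flip n (x : {ffun 'I_n -> bool}) (B : {set 'I_n}) : {ffun 'I_n -> bool} :=
  [ffun i => x i (+) (i \in B)].

Lemma flip_pdiff n (x y : {ffun 'I_n -> bool}) : flip x (pdiff x y) = y.
Proof. by apply/ffunP => i; rewrite ffunE inE; case: (x i) (y i) => [] []. Qed.

Lemma pdiff_flip n (x : {ffun 'I_n -> bool}) B : pdiff x (flip x B) = B.
Proof. by apply/setP => i; rewrite inE ffunE; case: (x i) (i \in B) => [] []. Qed.

Lemma flip0 n (x : {ffun 'I_n -> bool}) : flip x set0 = x.
Proof. by apply/ffunP => i; rewrite ffunE inE addbF. Qed.

Lemma flip_flip n (x : {ffun 'I_n -> bool}) B C :
  flip (flip x B) C = flip x ((B :\: C) :|: (C :\: B)).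
Proof.
apply/ffunP => i; rewrite !ffunE !inE.
by case: (x i) (i \in B) (i \in C) => [] [] [].
Qed.

Section Blocks.
Variables (n : nat) (f : {ffun 'I_n -> bool} -> bool).
Implicit Types (x : {ffun 'I_n -> bool}) (B C : {set 'I_n}).

Definition min_block x B := minset (fun B => f (flip x B) != f x) B.

Lemma min_block_neq x B : min_block x B -> f (flip x B) != f x.
Proof. by case/minsetP. Qed.

Lemma min_block_proper x B C : min_block x B -> C \proper B -> f (flip x C) = f x.
Proof.
case/minsetP => _ H CB; apply: contraTeq CB => /H CE.
by apply/negP => CB; move: (CB); rewrite (CE (proper_sub CB)) properxx.
Qed.

Lemma min_blockP x B : f (flip x B) != f x ->
  (forall C, C \proper B -> f (flip x C) = f x) -> min_block x B.
Proof.
move=> fB H; apply/minsetP; split=> // C fC CB; apply: contraNeq fC => CnB.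
by apply/eqP/H; rewrite properEneq CnB.
Qed.

Lemma min_block_ex x y : f x != f y -> exists2 B, min_block x B & B \subset pdiff x y.
Proof.
move=> fxy; have [|B mB sB] :=
  @minset_exists _ (fun B => f (flip x B) != f x) (pdiff x y).
  by rewrite flip_pdiff eq_sym.
by exists B.
Qed.

Lemma min_block_set0 x : ~~ min_block x set0.
Proof. by apply/negP => /min_block_neq; rewrite flip0 eqxx. Qed.

Lemma min_block_set1 x i : f (flip x [set i]) != f x -> min_block x [set i].
Proof.
move=> fi; apply: min_blockP => // C; rewrite properE subset1 => /andP[/orP[]/eqP->].
  by rewrite subxx.
by rewrite flip0.
Qed.

Definition min_blocks x s := [set B | min_block x B & #|B| == s].

(* Every position of a minimal block of x is sensitive for flip x B. *)
Lemma card_min_block s x B : (forall z, (#|min_blocks z 1| <= s)%N) -> min_block x B ->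
  (#|B| <= s)%N.
Proof.
move=> Hs mB; apply: leq_trans (Hs (flip x B)).
rewrite -(card_imset _ (@set1_inj _)); apply: subset_leq_card.
apply/subsetP => _ /imsetP[i iB ->]; rewrite inE cards1 eqxx andbT.
apply: min_block_set1; rewrite flip_flip.
have -> : B :\: [set i] :|: [set i] :\: B = B :\ i.
  apply/setP => j; rewrite !inE; have [->|ji] := eqVneq j i;
    by rewrite ?iB /= ?andbT ?andbF ?orbF.
by rewrite (min_block_proper mB) ?properD1 // eq_sym min_block_neq.
Qed.

(** Flipping [i] alone does not change [f], as [[set i]] is a proper part of [B]. Flipping [C]
    afterwards amounts to flipping [i |: C] in [x], so minimality is inherited from [B]. *)
Lemma min_blockD1 x B i : min_block x B -> i \in B -> B != [set i] ->
  min_block (flip x [set i]) (B :\ i).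
Proof.
move=> mB iB Bi.
have fE C : C \subset B :\ i -> flip (flip x [set i]) C = flip x (i |: C).
  move=> /subsetP CB; rewrite flip_flip; congr flip; apply/setP => j; rewrite !inE.
  case: (boolP (j \in C)) => [/CB|_]; first by rewrite !inE => /andP[-> _]; rewrite orbT.
  by rewrite andbF !orbF.
have fx : f (flip x [set i]) = f x.
  apply: (min_block_proper mB); rewrite properEneq eq_sym Bi sub1set //.
apply: min_blockP => [|C CB]; first by rewrite fE // setD1K // fx min_block_neq.
rewrite fx fE ?proper_sub //; apply: (min_block_proper mB).
rewrite -(setD1K iB); move: CB; rewrite !properE => /andP[CB nBC].
rewrite setUS //=; apply: contra nBC => /subsetP H; apply/subsetP => j jB.
have := H j; rewrite !inE; move: (jB); rewrite !inE => /andP[/negbTE-> ->] /=.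
by apply.
Qed.

(** Removing [i] injects these blocks into the minimal blocks of size [s] of [flip x [set i]]. For
    [s = 0] this fails, the empty set never being a block, but then [[set i]] is the only
    candidate. *)
Lemma card_min_blocks_at x s i N : (0 < N)%N ->
  (forall z, (#|min_blocks z s| <= N)%N) ->
  (#|[set B in min_blocks x s.+1 | i \in B]| <= N)%N.
Proof.
move=> N0 HN; case: s HN => [_|s HN].
  apply: leq_trans N0; rewrite -[X in (_ <= X)%N](cards1 [set i]); apply: subset_leq_card.
  apply/subsetP => B; rewrite !inE => /andP[/andP[_ B1] iB].
  have /cards1P[j Bj] := B1; move: iB; rewrite Bj inE => /eqP ->; exact: eqxx.
apply: leq_trans (HN (flip x [set i])).
rewrite -(@card_in_imset _ _ (fun B => B :\ i)) => [|B C]; last first.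
  by rewrite !inE => /andP[_ iB] /andP[_ iC] BC; rewrite -(setD1K iB) BC setD1K.
apply: subset_leq_card; apply/subsetP => _ /imsetP[B + ->].
rewrite !inE => /andP[/andP[mB /eqP sB] iB]; apply/andP; split.
  apply: min_blockD1 => //; apply/eqP => Bi; move: sB; by rewrite Bi cards1.
by move: sB; rewrite (cardsD1 i) iB add1n => -[->].
Qed.

End Blocks.

(* Double counting of the pairs of a block B in F and a position of B queried. *)
Lemma card_hit_family (R : realType) (I : finType) (w : I -> R) n (Q : I -> {set 'I_n})
    (F : {set {set 'I_n}}) (d : R) (T D : nat) :
  (forall i, 0 <= w i) -> \sum_i w i = 1 -> (forall i, (#|Q i| <= T)%N) ->
  (forall B, B \in F -> \sum_i w i * [disjoint Q i & B]%:R <= d) ->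
  (forall j, (#|[set B in F | j \in B]| <= D)%N) ->
  #|F|%:R * (1 - d) <= (T * D)%:R.
Proof.
move=> w0 w1 QT HF HD.
have hit B : B \in F -> 1 - d <= \sum_i w i * (~~ [disjoint Q i & B])%:R.
  move=> /HF Hd; have -> : \sum_i w i * (~~ [disjoint Q i & B])%:R =
      1 - \sum_i w i * [disjoint Q i & B]%:R.
    rewrite -[X in X - _]w1 -sumrB; apply: eq_bigr => i _.
    by case: [disjoint _ & _]; rewrite ?mulr1 ?mulr0 ?subrr ?subr0.
  by rewrite lerB.
have cnt i : (\sum_(B in F) (~~ [disjoint Q i & B]) <= T * D)%N.
  apply: (@leq_trans (\sum_(B in F) \sum_(j in Q i) (j \in B))).
    apply: leq_sum => B _; case: (boolP [disjoint Q i & B]) => //.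
    move=> /pred0Pn[j /= /andP[jQ jB]].
    by rewrite (bigD1 j) //= jB.
  rewrite exchange_big /=; apply: (@leq_trans (\sum_(j in Q i) D)).
    apply: leq_sum => j _; apply: leq_trans (HD j).
    by rewrite -sum1dep_card big_mkcondr; apply: leq_sum => B _; case: (j \in B).
  by rewrite sum_nat_const leq_mul2r QT orbT.
rewrite mulr_natl -sumr_const.
apply: le_trans (_ : \sum_(B in F) \sum_i w i * (~~ [disjoint Q i & B])%:R <= _).
  by apply: ler_sum => B; exact: hit.
have -> : (T * D)%:R = \sum_i w i * (T * D)%:R by rewrite -mulr_suml w1 mul1r.
rewrite exchange_big /=; apply: ler_sum => i _.
by rewrite -mulr_sumr -natr_sum ler_wpM2l // ler_nat.
Qed.

(** Induction on [s]: each block of size [s.+1] is hit with probability at least 1/2, and each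
    position lies in at most [(2 * T) ^ s] of them, so double counting gains a factor [2 * T]. *)
Lemma card_min_blocks (R : realType) (I : finType) (w : I -> R) n
    (f : {ffun 'I_n -> bool} -> bool) (t : I -> dtree bool n) T x s :
  (forall i, 0 <= w i) -> \sum_i w i = 1 ->
  (forall i x, (queries (t i) x <= T)%N) ->
  (forall x y, f x != f y ->
     \sum_i w i * [disjoint queried (t i) x & pdiff x y]%:R <= 2^-1) ->
  (0 < T)%N -> (#|min_blocks f x s| <= (2 * T) ^ s)%N.
Proof.
move=> w0 w1 tT ht T0; elim: s x => [|s IH] x.
  rewrite expn0 (_ : min_blocks f x 0 = set0) ?cards0 //; apply/setP => B.
  rewrite !inE; apply/negbTE/negP => /andP[+ /eqP/cards0_eq B0].
  by rewrite B0; apply/negP/min_block_set0.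
have := @card_hit_family R I w n (fun i => queried (t i) x) (min_blocks f x s.+1) 2^-1 T
  ((2 * T) ^ s) w0 w1.
rewrite (_ : 1 - 2^-1 = 2^-1 :> R); last by lra.
rewrite ler_pdivrMr // -natrM ler_nat => H.
rewrite expnS -mulnA mulnC; apply: H => [i|B|j].
- exact: leq_trans (card_queried _ _) (tT i x).
- rewrite inE => /andP[/min_block_neq fB _].
  by have := ht x (flip x B); rewrite pdiff_flip eq_sym; apply.
- by apply: card_min_blocks_at => //; rewrite expn_gt0 muln_gt0 T0.
Qed.

(** The case [k = 1] bounds the sensitivity, hence the block sizes, by [s]. The sum over the [s.+1]
    possible sizes has terms at most [s.+1 ^ s]. *)
Lemma card_all_min_blocks n (f : {ffun 'I_n -> bool} -> bool) s x :
  (forall z k, (#|min_blocks f z k| <= s ^ k)%N) ->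
  (#|[set B | min_block f x B]| <= s.+1 ^ s.+1)%N.
Proof.
move=> Hs; have szB B : min_block f x B -> (#|B| < s.+1)%N.
  by move=> mB; rewrite ltnS; apply: card_min_block mB => z; exact: Hs.
apply: (@leq_trans (\sum_(k < s.+1) #|min_blocks f x k|)).
  under eq_bigr do rewrite -sum1dep_card.
  rewrite -sum1dep_card big_mkcond; under [X in (_ <= X)%N]eq_bigr do rewrite big_mkcond.
  rewrite exchange_big /=; apply: leq_sum => B _.
  case: ifP => // mB; rewrite (bigD1 (Ordinal (szB B mB))) //= eqxx.
  exact: leq_addr.
apply: (@leq_trans (\sum_(k < s.+1) s.+1 ^ s)).
  apply: leq_sum => k _; apply: leq_trans (Hs _ _) _.
  apply: (@leq_trans (s.+1 ^ k)).
    by case: (k : nat) => [|k1]; rewrite ?expn0 ?leq_exp2r.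
  by rewrite leq_pexp2l // -ltnS.
by rewrite sum_nat_const card_ord expnS.
Qed.

(** One query hits at most one singleton, so two sensitive positions of one input would give
    [2 * (1 - d) <= 1]. Hence the sensitivity is at most 1 and every minimal block is a
    singleton. *)
Lemma dictator_of_hitting (R : realType) (I : finType) (w : I -> R) n
    (f : {ffun 'I_n -> bool} -> bool) (t : I -> dtree bool n) (d : R) :
  (forall i, 0 <= w i) -> \sum_i w i = 1 ->
  (forall i x, (queries (t i) x <= 1)%N) -> d < 2^-1 ->
  (forall x y, f x != f y ->
     \sum_i w i * [disjoint queried (t i) x & pdiff x y]%:R <= d) ->
  (forall x y, f x = f y) \/ exists i, forall x y, (f x == f y) = (x i == y i).
Proof.
move=> w0 w1 tT dhalf ht.
have m1 x : (#|min_blocks f x 1| <= 1)%N.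
  have : #|min_blocks f x 1|%:R * (1 - d) <= (1 * 1)%:R.
    apply: (@card_hit_family R I w n (fun i => queried (t i) x)) => // [i|B|j].
    - exact: leq_trans (card_queried _ _) (tT i x).
    - rewrite inE => /andP[/min_block_neq fB _].
      by have := ht x (flip x B); rewrite pdiff_flip eq_sym; apply.
    - apply: card_min_blocks_at => // z; rewrite (_ : min_blocks f z 0 = set0) ?cards0 //.
      apply/setP => B; rewrite !inE; apply/negbTE/negP => /andP[+ /eqP/cards0_eq B0].
      by rewrite B0; apply/negP/min_block_set0.
  rewrite leqNgt => Hd; apply/negP; rewrite -(ltr_nat R) => c1.
  have : (2 : R) <= #|min_blocks f x 1|%:R by rewrite ler_nat -(ltr_nat R).
  by move=> c2; nra.
have sens x y : f x != f y -> exists i, x i != y i /\ f (flip x [set i]) != f x.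
  move=> /min_block_ex[B mB Bxy].
  have := card_min_block m1 mB; rewrite leq_eqVlt ltnS leqn0 cards_eq0.
  move=> /orP[/cards1P[i Bi]|/eqP B0]; last first.
    by move: mB; rewrite B0 (negbTE (min_block_set0 _ _)).
  exists i; split; last by rewrite -Bi min_block_neq.
  by move: Bxy; rewrite Bi sub1set inE.
have uniqs x i j : f (flip x [set i]) != f x -> f (flip x [set j]) != f x -> i = j.
  move=> fi fj; have := m1 x; rewrite leqNgt; apply: contraNeq => ij.
  apply: (@leq_trans #|[set [set i]; [set j]]|).
    by rewrite cards2 (inj_eq set1_inj) ij.
  apply/subset_leq_card/subsetP => B; rewrite !inE.
  by move=> /orP[]/eqP->; rewrite cards1 eqxx min_block_set1.
have [H|/existsPn H] := boolP [exists x, exists y, f x != f y]; last first.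
  left=> x y; have /existsPn/(_ y) := H x; by rewrite negbK => /eqP.
right; have /existsP[x0 /existsP[y0 fxy]] := H.
have [i [_ si]] := sens _ _ fxy; exists i.
(* As the sensitive position of [x] is unique, every input of the other value differs from [x]
   there. *)
have key x : f (flip x [set i]) != f x -> forall y, f x != f y -> x i != y i.
  by move=> sx y /sens[j [xyj sj]]; rewrite (uniqs _ _ _ sx sj).
(* Applying [key] at this neighbour of [x0], which has the other value, gives the converse
   implication in [H0]. *)
have flipi : f (flip (flip x0 [set i]) [set i]) != f (flip x0 [set i]).
  by rewrite flip_flip setDv setU0 flip0 eq_sym.
have H0 y : (f x0 == f y) = (x0 i == y i).
  apply/idP/idP; last by apply: contraTT; exact: key.
  apply: contraTT => xy.
  apply/negP => /eqP fy.
  have := key _ flipi y; rewrite -fy => /(_ si).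
  by rewrite ffunE inE eqxx addbT; move: xy; case: (x0 i) (y i) => [] [].
move=> x y; have := H0 x; have := H0 y.
by case: (f x0) (f x) (f y) (x0 i) (x i) (y i) => [] [] [] [] [] [].
Qed.

(** * Querying until a certificate is found *)

Section Certify.
Variables (n : nat) (f : {ffun 'I_n -> bool} -> bool).
Implicit Types (t : dtree bool n) (x y : {ffun 'I_n -> bool}).
Implicit Types (S : {set {ffun 'I_n -> bool}}).

(** Sequential composition in continuation style: the answer of [t] is discarded, and [k] receives
    what [S] has been narrowed to by the bits read. *)
Fixpoint extend t S (k : {set {ffun 'I_n -> bool}} -> dtree bool n) : dtree bool n :=
  match t with
  | Answer _ => k S
  | Query i u => Query i (fun b =>
      extend (u b) (S :&: [set y : {ffun 'I_n -> bool} | y i == b]) k)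
  end.

Definition agree t x : {set {ffun 'I_n -> bool}} :=
  [set y : {ffun 'I_n -> bool} | [forall i in queried t x, y i == x i]].

Lemma extendE t S k x :
  output (extend t S k) x = output (k (S :&: agree t x)) x /\
  queries (extend t S k) x = (queries t x + queries (k (S :&: agree t x)) x)%N.
Proof.
elim: t S => [b|i u IH] S /=.
  suff -> : agree (Answer b) x = setT by rewrite setIT.
  by apply/setP => y; rewrite !inE; apply/forall_inP => i; rewrite inE.
have [-> ->] := IH (x i) (S :&: [set y : {ffun 'I_n -> bool} | y i == x i]).
suff -> : S :&: [set y : {ffun 'I_n -> bool} | y i == x i] :&: agree (u (x i)) x =
    S :&: agree (Query i u) x.
  by [].
rewrite -setIA; congr (_ :&: _); apply/setP => y; rewrite !inE /=.
apply/andP/forall_inP => [[yi /forall_inP H] j|H].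
  by rewrite !inE => /orP[/eqP->|/H].
split; first by apply: H; rewrite setU11.
by apply/forall_inP => j jQ; apply: H; rewrite inE jQ orbT.
Qed.

(* S is the set of inputs consistent with the answers received so far; t0 is the
   fallback once all of ts has been run. *)
Fixpoint certify t0 (ts : seq (dtree bool n)) S : dtree bool n :=
  if [pick b | [forall y in S, f y == b]] is Some b then Answer b
  else if ts is t :: ts' then extend t S (certify t0 ts') else t0.

(** The input [x] never leaves the set of consistent inputs, so a constant value of [f] on that set
    is [f x]. Correctness thus does not depend on [ts]. *)
Lemma output_certify t0 ts S x :
  output t0 x = f x -> x \in S -> output (certify t0 ts S) x = f x.
Proof.
move=> ht0; elim: ts S => [|t ts IH] S xS /=.
  by case: pickP => //= b /forall_inP/(_ x xS)/eqP.
case: pickP => [b /forall_inP/(_ x xS)/eqP|_] //=.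
rewrite (extendE t S _ x).1 IH // inE xS inE.
by apply/forall_inP.
Qed.

(** The event that the runs of [ts] fail to certify the value at [x]: some input of the other value
    is still consistent. *)
Definition undecided (ts : seq (dtree bool n)) S x : bool :=
  [exists y in S, (f y != f x) && all (fun t => y \in agree t x) ts].

(** Tree number [j] runs only if the first [j] trees leave [x] undecided, and [t0] only if all of
    [ts] does. *)
Lemma queries_certify t0 ts S x T :
  (forall t, t \in ts -> (queries t x <= T)%N) ->
  (queries (certify t0 ts S) x <=
   \sum_(j < size ts) T * undecided (take j ts) S x + undecided ts S x * queries t0 x)%N.
Proof.
have und0 S' : [pick b | [forall y in S', f y == b]] = None -> undecided [::] S' x.
  case: pickP => // /(_ (f x))/negbT/forall_inPn[y yS fy] _.
  by apply/exists_inP; exists y => //; rewrite fy.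
elim: ts S => [|t ts IH] S tT /=.
  by case E: [pick b | _] => [b|] //=; rewrite und0 // mul1n leq_addl.
case E: [pick b | _] => [b|] //=.
rewrite (extendE t S _ x).2 big_ord_recl /= ?take0 und0 // muln1 -addnA.
apply: leq_add; first by apply: tT; rewrite mem_head.
have undS ts' : undecided ts' (S :&: agree t x) x = undecided (t :: ts') S x.
  apply: eq_existsb => y; rewrite inE /=.
  by rewrite -!andbA; congr (_ && _); rewrite andbCA.
apply: leq_trans (IH _ _) _ => [t' t'ts|]; first by apply: tT; rewrite inE t'ts orbT.
by rewrite undS leq_add2r; apply: leq_sum => j _; rewrite undS.
Qed.

End Certify.

Lemma sum_pow2V_le (R : realType) m : \sum_(i < m) (2^-1 : R) ^+ i <= 2.
Proof.
suff -> : \sum_(i < m) (2^-1 : R) ^+ i = 2 - 2 * 2^-1 ^+ m.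
  by rewrite lerBlDr lerDl mulr_ge0 // exprn_ge0 // invr_ge0.
elim: m => [|m IH]; first by rewrite big_ord0 expr0 mulr1 subrr.
rewrite big_ord_recr /= IH exprS; lra.
Qed.

(** * Independent repetition and the union bound *)

Section Repeat.
Variables (R : realType) (n : nat) (f : {ffun 'I_n -> bool} -> bool).
Variables (I : finType) (w : I -> R) (t : I -> dtree bool n) (T k : nat).
Hypothesis w0 : forall i, 0 <= w i.
Hypothesis w1 : \sum_i w i = 1.
Hypothesis tT : forall i x, (queries (t i) x <= T)%N.
Hypothesis ht : forall x y, f x != f y ->
  \sum_i w i * [disjoint queried (t i) x & pdiff x y]%:R <= 2^-1.
Hypothesis hk : forall x, (#|[set B | min_block f x B]| <= 2 ^ k)%N.

(** The first [k] runs offset the [2 ^ k] blocks of the union bound; [n] more bring the failure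
    probability down to [2 ^ -n], which pays for the [n] queries of the fallback tree. *)
Let K := (k + n)%N.
Let W (g : {ffun 'I_K -> I}) := \prod_l w (g l).
Let ts (g : {ffun 'I_K -> I}) := [seq t (g l) | l <- enum 'I_K].

Let W_ge0 g : 0 <= W g.
Proof. by apply: prodr_ge0. Qed.

Let W_sum : \sum_g W g = 1.
Proof. by rewrite -(bigA_distr_bigA (fun _ => w)) big1. Qed.

(** A surviving [y] of the other value differs from [x] on a set containing a minimal block, and all
    of the first [j] runs missed that block. *)
Let undecided_le g j x :
  (undecided f (take j (ts g)) setT x <=
   \sum_(B | min_block f x B) \prod_(l < K | l < j) [disjoint queried (t (g l)) x & B])%N.
Proof.
rewrite /undecided; case: exists_inP => // -[y _ /andP[fy /allP ay]].
have [|B mB Bxy] := @min_block_ex n f x y; first by rewrite eq_sym.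
rewrite (bigD1 B) //= big1 // => l lj.
suff -> : [disjoint queried (t (g l)) x & B] by [].
apply/pred0Pn => -[i /= /andP[iQ /(subsetP Bxy)]].
rewrite inE => /negP; apply; rewrite eq_sym.
have /ay : t (g l) \in take j (ts g).
  rewrite /ts -map_take; apply: map_f; rewrite in_take ?mem_enum //.
  by rewrite index_enum_ord.
by rewrite inE => /forall_inP; apply.
Qed.

Let prob_undecided j x : (j <= K)%N ->
  \sum_g W g * (undecided f (take j (ts g)) setT x)%:R <= 2 ^+ k * 2^-1 ^+ j.
Proof.
move=> jK.
apply: (@le_trans _ _ (\sum_(B | min_block f x B) \sum_(g : {ffun 'I_K -> I})
    \prod_(l < K) (w (g l) *
      (if (l < j)%N then [disjoint queried (t (g l)) x & B] else true)%:R))).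
  rewrite exchange_big /=; apply: ler_sum => g _.
  under eq_bigr do rewrite big_split /= -/(W g).
  rewrite -mulr_sumr; apply: ler_wpM2l; first exact: W_ge0.
  apply: (@le_trans _ _ (\sum_(B | min_block f x B)
      \prod_(l < K | l < j) [disjoint queried (t (g l)) x & B])%N%:R).
    by rewrite ler_nat undecided_le.
  rewrite natr_sum; apply: ler_sum => B _; rewrite natr_prod big_mkcond /=.
  by rewrite le_eqVlt; apply/orP; left; apply/eqP; apply: eq_bigr => l _; case: ifP.
apply: (@le_trans _ _ (\sum_(B | min_block f x B) 2^-1 ^+ j)); last first.
  rewrite sumr_const -[X in X <= _]mulr_natl;
  apply: ler_wpM2r; first by rewrite exprn_ge0 // invr_ge0.
  by rewrite -natrX ler_nat; have := hk x; rewrite cardsE.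
apply: ler_sum => B mB.
(* Independence: the sum over [g] factors over the runs. A run with [l < j] contributes at most 1/2,
   a later one its total weight 1. *)
rewrite -(bigA_distr_bigA (fun (l : 'I_K) i => w i *
  (if (l < j)%N then [disjoint queried (t i) x & B] else true)%:R)).
have -> : 2^-1 ^+ j = \prod_(l < K) (if (l < j)%N then 2^-1 else 1) :> R.
  by rewrite -big_mkcond -(big_ord_widen _ (fun=> 2^-1)) // prodr_const card_ord.
apply: ler_prod => l _; apply/andP; split.
  by apply: sumr_ge0 => i _; rewrite mulr_ge0.
case: ifP => _; last by under eq_bigr do rewrite mulr1; rewrite w1.
by have := @ht x (flip x B); rewrite pdiff_flip; apply; rewrite eq_sym min_block_neq.
Qed.

(** The first [k] runs cost at most [T] each. Run [k + j] takes place with probability at most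
    [2 ^ -j], so the later runs cost at most [2 * T] in expectation, and the fallback at most 1. *)
Lemma R0_le_repeat : R0 R (pfun_of f) <= (T * (k + 2) + 1)%:R.
Proof.
have [t0 /all_and2[ot0 qt0]] := total_tree true f.
apply: (@R0_le_mixture _ _ R _ _ W (fun g => certify f t0 (ts g) setT)) => //.
  by move=> g x b [<-]; rewrite output_certify // inE.
move=> x _.
apply: (@le_trans _ _ (\sum_(j < K)
     T%:R * (\sum_g W g * (undecided f (take j (ts g)) setT x)%:R)
   + n%:R * (\sum_g W g * (undecided f (take K (ts g)) setT x)%:R))).
  under [X in _ <= X + _]eq_bigr do rewrite mulr_sumr.
  rewrite [X in _ <= X + _]exchange_big /= mulr_sumr -big_split /=; apply: ler_sum => g _.
  under [X in _ <= X + _]eq_bigr do rewrite mulrCA.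
  rewrite -mulr_sumr [n%:R * _]mulrCA -mulrDr; apply: ler_wpM2l; first exact: W_ge0.
  under eq_bigr do rewrite -natrM.
  rewrite -natr_sum -natrM -natrD ler_nat.
  have szts : size (ts g) = K by rewrite size_map size_enum_ord.
  have := @queries_certify n f t0 (ts g) setT x T.
  have -> : take K (ts g) = ts g by rewrite -szts take_size.
  rewrite szts [(n * _)%N]mulnC qt0; apply => _ /mapP[l _ ->].
  exact: tT.
rewrite natrD natrM; apply: lerD.
  rewrite -mulr_sumr; apply: ler_wpM2l => //.
  rewrite big_split_ord /= natrD; apply: lerD.
    rewrite -[X in _ <= X%:R](card_ord k) -sumr_const; apply: ler_sum => j _.
    apply: le_trans (_ : \sum_g W g <= _); last by rewrite W_sum.
    apply: ler_sum => g _; apply: ler_piMr; first exact: W_ge0.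
    by rewrite lern1 leq_b1.
  apply: le_trans (sum_pow2V_le R n); apply: ler_sum => j _.
  apply: le_trans (prob_undecided _ _) _; first by rewrite leq_add2l ltnW.
  by rewrite exprD mulrA -exprMn mulfV ?expr1n ?mul1r.
apply: (@le_trans _ _ (n%:R * (2 ^+ k * 2^-1 ^+ K))).
  by apply: ler_wpM2l => //; exact: prob_undecided.
have -> : 2 ^+ k * 2^-1 ^+ K = 2^-1 ^+ n :> R.
  by rewrite /K exprD mulrA -exprMn mulfV // expr1n mul1r.
by rewrite exprVn ler_pdivrMr ?exprn_gt0 // mul1r -natrX ler_nat ltnW // ltn_expl.
Qed.

End Repeat.

(** * The two bounds *)

Lemma R0_le_tree (A : finType) n (R : realType) (h : pfun A n) (t : dtree A n) m :
  computes h t -> (forall x, (queries t x <= m)%N) -> R0 R h <= m%:R.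
Proof.
move=> ht tm.
apply: (@R0_le_mixture _ _ R h unit (fun=> 1) (fun=> t)) => //.
  by rewrite big_const card_unit /= addr0.
by move=> x _; rewrite big_const card_unit /= addr0 mul1r ler_nat.
Qed.

Lemma gap_dictator (A : finType) n (a0 : A) (R : realType) (h : pfun A n)
    (e : bool -> A) (f : {ffun 'I_n -> bool} -> bool) :
  sabotages h e f -> R0 R h < 3 / 2 ->
  (forall x y, f x = f y) \/ exists i, forall x y, (f x == f y) = (x i == y i).
Proof.
move=> hef R32.
have [|I [w [t [w0 w1 tT ht]]]] :=
  (* The midpoint of [R0 R h] and 3/2 exceeds [R0 R h], and less 1 it stays below 1/2. *)
  @truncated_mixture A n a0 R h e f ((R0 R h + 3 / 2) / 2) 1 hef; first lra.
apply: (@dictator_of_hitting R I w n f t ((R0 R h + 3 / 2) / 2 - 1)) => //; first lra.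
by move=> x y fxy; have := ht x y fxy; rewrite mul1r.
Qed.

Lemma dictator_R0_le1 n (R : realType) (f : {ffun 'I_n -> bool} -> bool) :
  ((forall x y, f x = f y) \/ exists i, forall x y, (f x == f y) = (x i == y i)) ->
  R0 R (pfun_of f) <= 1 /\ RS f R <= 1.
Proof.
have sabP s (p : {ffun 'I_n -> symbol}) : p \in sab_inputs f s ->
    exists x y, f x != f y /\ forall i, x i != y i -> p i = s.
  rewrite inE => /existsP[x /existsP[y /andP[fxy /forallP H]]]; exists x, y.
  split=> // i xy.
  apply/eqP; apply: contraNT xy => ps; have := H i; rewrite ps /=.
  by move=> /andP[/eqP <- /eqP[->]].
case=> [fc|[i fi]]; split.
- apply: (@R0_le_tree _ _ R _ (Answer (f [ffun=> false])) 1) => // x b [<-]; exact: fc.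
- apply: (@R0_le_tree _ _ R _ (Answer false) 1) => // p b.
  have nsab s : (p \in sab_inputs f s) = false.
    by apply/negP => /sabP[x [y [/eqP fxy _]]]; apply: fxy.
  by rewrite /fsab !nsab.
- apply: (@R0_le_tree _ _ R _ (Query i (fun b => Answer (f [ffun=> b]))) 1) => //.
  by move=> x b [<-]; apply/eqP; rewrite fi ffunE.
(* Sabotaged words of a dictator carry their special symbol at [i], so reading that entry decides
   [fsab f]. *)
- apply: (@R0_le_tree _ _ R _ (Query i (fun s => Answer (s == Dagger))) 1) => // p b.
  have sabi s : p \in sab_inputs f s -> p i = s.
    by move=> /sabP[x [y [fxy]]]; apply; rewrite -fi.
  rewrite /fsab; case: ifP => [/sabi /= -> [<-] //|_].
  by case: ifP => [/sabi /= -> [<-]|].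
Qed.

Lemma RS_ge n (R : realType) (f : {ffun 'I_n -> bool} -> bool) :
  1 < RS f R -> 3 / 2 <= RS f R.
Proof.
move=> RS1; rewrite leNgt; apply/negP => H.
have [_] := dictator_R0_le1 R (gap_dictator Star (@fsab_sabotages n f) H).
by rewrite leNgt RS1.
Qed.

Lemma R0_RS_ge n (R : realType) (f : {ffun 'I_n -> bool} -> bool) :
  1 < R0 R (pfun_of f) -> 3 / 2 <= R0 R (pfun_of f) /\ 3 / 2 <= RS f R.
Proof.
move=> R01; split; rewrite leNgt; apply/negP => H.
  have [] := dictator_R0_le1 R (gap_dictator true (@pfun_of_sabotages n f) H).
  by rewrite leNgt R01.
have [] := dictator_R0_le1 R (gap_dictator Star (@fsab_sabotages n f) H).
by rewrite leNgt R01.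
Qed.

(** * Logarithmic estimates and constants *)

Lemma ln_ge (R : realType) (x : R) : 0 < x -> 1 - x^-1 <= ln x.
Proof.
move=> x0; have := @le_ln1Dx R (x^-1 - 1).
rewrite addrCA subrr addr0 lnV ?posrE // => H.
have : - ln x <= x^-1 - 1 by apply: H; rewrite ltrBrDl subrr invr_gt0.
lra.
Qed.

Lemma ln_ge_third (R : realType) (x : R) : 3 / 2 <= x -> 3^-1 <= ln x.
Proof.
move=> x32; apply: le_trans (ln_ge _); last lra.
have : x^-1 <= (3 / 2)^-1 by rewrite lef_pV2 ?posrE //; lra.
lra.
Qed.

(** From [2 ^ (L - 1) < N <= 16 * r] and [ln 2 >= 1/2] follows [L <= 5 + 2 * ln r], where [L] is
    [up_log 2 N]; and [5 <= 15 * ln r] because [ln r >= 1/3]. *)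
Lemma up_log_le (R : realType) (N : nat) (r : R) :
  3 / 2 <= r -> (1 < N)%N -> N%:R <= 9 * r -> (up_log 2 N)%:R <= 17 * ln r.
Proof.
move=> r32 N1 Nr; have /andP[+ _] := up_log_bounds (isT : (1 < 2)%N) N1.
have L0 : (0 < up_log 2 N)%N by rewrite up_log_gt0.
rewrite -{2}(prednK L0) -natr1 -(ltr_nat R) natrX => mN.
have l3 := ln_ge_third r32.
have r0 : 0 < r by lra.
have ln2 : 2^-1 <= ln 2 :> R by apply: le_trans (ln_ge _) => //; lra.
have e16 : 2 ^+ 4 = 16 :> R by rewrite -natrX.
have : ln (2 ^+ (up_log 2 N).-1) <= ln (2 ^+ 4 * r).
  rewrite ler_ln ?posrE ?mulr_gt0 ?exprn_gt0 // e16.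
  apply: le_trans (ltW mN) _; lra.
rewrite lnM ?posrE ?exprn_gt0 //.
have lnX k : ln (2 ^+ k) = k%:R * ln 2 :> R by rewrite lnXn // mulr_natl.
rewrite (lnX (up_log 2 N).-1) (lnX 4).
move: ((up_log 2 N).-1%:R : R) (ler0n R (up_log 2 N).-1) => m m0 H.
move: (ln 2) (ln r) ln2 l3 H => a z a2 z3 H; nra.
Qed.

Lemma R0_le_RS n (R : realType) (f : {ffun 'I_n -> bool} -> bool) :
  3 / 2 <= RS f R -> R0 R (pfun_of f) <= 700 * (RS f R ^+ 2 * ln (RS f R)).
Proof.
set r := RS f R => r32.
(* With expected cost below [2 * r], a block is missed with probability at most [(2 * r - 1) / T],
   which is below 1/2 since [T > 4 * r - 1]. *)
pose T := Num.truncn (4 * r).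
have /andP[Tle Tge] : T%:R <= 4 * r < T.+1%:R by apply: truncn_itv; lra.
rewrite -natr1 in Tge.
have T0 : (0 < T)%N by rewrite -(ltr_nat R); lra.
have [|I [w [t [w0 w1 tT ht]]]] :=
  @truncated_mixture symbol n Star R (fsab f) Bit f (2 * r) T (@fsab_sabotages n f).
  by rewrite -/(RS f R) -/r; lra.
have ht2 x y : f x != f y ->
    \sum_i w i * [disjoint queried (t i) x & pdiff x y]%:R <= 2^-1.
  move=> /ht H; rewrite -(ler_pM2l (_ : 0 < T%:R :> R)) ?ltr0n //; lra.
pose L := up_log 2 (2 * T).+1.
have /andP[Llt Lge] : (2 ^ L.-1 < (2 * T).+1 <= 2 ^ L)%N.
  by apply: up_log_bounds => //; rewrite ltnS muln_gt0.
have hk x : (#|[set B | min_block f x B]| <= 2 ^ (L * (2 * T).+1))%N.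
  apply: (@leq_trans ((2 * T).+1 ^ (2 * T).+1)).
    by apply: card_all_min_blocks => z k; exact: (@card_min_blocks R I w n f t T z k).
  by rewrite expnM leq_exp2r.
have := R0_le_repeat w0 w1 tT ht2 hk.
move=> /le_trans; apply.
have l3 := ln_ge_third r32.
have r0 : 0 < r by lra.
have Lr : L%:R <= 17 * ln r.
  by apply: up_log_le => //; rewrite ?ltnS ?muln_gt0 // -natr1 natrM; lra.
rewrite !(natrD, natrM) -[(2 * T).+1%:R]natr1 natrM.
move: (L%:R : R) (T%:R : R) Lr Tle Tge (ler0n R L) (ler0n R T) => l T' Lr Tle Tge l0 T'0.
have T9 : 2 * T' + 1 <= 9 * r by lra.
have lT : l * (2 * T' + 1) <= 17 * ln r * (9 * r) by apply: ler_pM => //; lra.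
(* The right side is [612 * r ^ 2 * ln r + 8 * r]; the rest of 700 absorbs [8 * r + 1], as
   [r >= 3/2] and [ln r >= 1/3]. *)
have : T' * (l * (2 * T' + 1) + 2) <= 4 * r * (17 * ln r * (9 * r) + 2).
  apply: ler_pM => //; last lra.
  by apply: addr_ge0 => //; apply: mulr_ge0 => //; lra.
move: (ln r) l3 {Lr lT} => z z3 H; nra.
Qed.

Theorem theorem32 (R : realType) :
  (exists C : R, 0 < C /\
     forall (n : nat) (f : {ffun 'I_n -> bool} -> bool),
       1 < RS f R ->
       R0 R (pfun_of f) <= C * (RS f R ^+ 2 * ln (RS f R)))
  /\
  (exists c : R, 0 < c /\
     forall (n : nat) (f : {ffun 'I_n -> bool} -> bool),
       1 < R0 R (pfun_of f) ->
       c * Num.sqrt (R0 R (pfun_of f) / ln (R0 R (pfun_of f))) <= RS f R).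
Proof.
split.
  exists 700; split=> [|n f /RS_ge]; [lra | exact: R0_le_RS].
exists 30^-1; split=> [|n f /R0_RS_ge[a32 r32]]; first lra.
have := R0_le_RS r32; move: (R0 _ _) (RS f R) a32 r32 => a r a32 r32 ar.
have la := ln_ge_third a32; have lr := ln_ge_third r32.
rewrite ler_pdivrMl //.
have -> : 30 * r = Num.sqrt ((30 * r) ^+ 2) by rewrite sqrtr_sqr ger0_norm //; lra.
apply: ler_wsqrtr; rewrite ler_pdivrMr; last lra.
(* The goal is [a <= 900 * r ^ 2 * ln a]. If [a <= r ^ 2], then [ln a >= 1/3] suffices; otherwise
   [2 * ln r <= ln a] turns the first bound into [a <= 350 * r ^ 2 * ln a]. *)
have [ar2|r2a] := leP a (r ^+ 2).
  by move: (ln a) la => z la; nra.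
have : ln (r ^+ 2) <= ln a.
  by rewrite ler_ln ?posrE ?exprn_gt0 //; [exact: ltW | lra | lra].
rewrite lnXn; last lra.
move: (ln a) (ln r) la lr ar => z y la lr ar yz.
by apply: le_trans ar _; nra.
Qed.
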